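(* The proof system $\mathbf{E}^W$ is sound and strongly complete with respect to the class of all neighborhood frames.
   Context: Fix a nonempty set $\mathbf{P}$ of propositional variables, $p\in\mathbf{P}$. $\mathcal{L}(W)$: $\varphi::=p\mid\neg\varphi\mid\varphi\land\varphi\mid W\varphi$; other Boolean connectives are defined as usual. A neighborhood frame is $\langle S,N\rangle$ with $S$ a nonempty set and $N:S\to\mathcal{P}(\mathcal{P}(S))$; a model $\mathcal{M}=\langle S,N,V\rangle$ based on it adds $V:\mathbf{P}\to\mathcal{P}(S)$. With $\varphi^{\mathcal{M}}=\{s\in S\mid\mathcal{M},s\vDash\varphi\}$: $\mathcal{M},s\vDash p$ iff $s\in V(p)$; Boolean connectives as usual; $\mathcal{M},s\vDash W\varphi$ iff $\varphi^{\mathcal{M}}\in N(s)$ and $s\notin\varphi^{\mathcal{M}}$. The proof system $\mathbf{E}^W$ for $\mathcal{L}(W)$ has as axioms all instances of propositional tautologies and all instances of $\texttt{WE}$: $W\varphi\to\neg\varphi$; its rules are modus ponens and $\texttt{REW}$: from $\varphi\leftrightarrow\psi$ infer $W\varphi\leftrightarrow W\psi$ (applied to theorems). Sound with respect to a class of frames: every theorem is true at every state of every model based on a frame in the class. Strongly complete: for every set $\Gamma\cup\{\varphi\}$ of formulas, if $\varphi$ is true at every state, in every model based on a frame in the class, at which all of $\Gamma$ is true, then $\vdash\bigwedge\Gamma_0\to\varphi$ for some finite $\Gamma_0\subseteq\Gamma$ (equivalently, every consistent set is satisfiable in a model based on a frame in the class). *)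

(* Defs.v *)
From Stdlib Require List.
From mathcomp Require Import all_boot.
From mathcomp Require Import classical_sets.

Set Implicit Arguments.
Unset Printing Implicit Defensive.

Local Open Scope classical_set_scope.

Inductive form (P : Type) : Type :=
| Var of P
| Neg of form P
| And of form P & form P
| W of form P.

Definition Or (P : Type) (a b : form P) : form P := Neg (And (Neg a) (Neg b)).
Definition Imp (P : Type) (a b : form P) : form P := Neg (And a (Neg b)).
Definition Iff (P : Type) (a b : form P) : form P := And (Imp a b) (Imp b a).

(* The language has no primitive constant: [Top] is a tautology built from a
   variable [p0], which exists because the set of variables is nonempty. It
   only serves as the empty conjunction. *)
Definition Top (P : Type) (p0 : P) : form P := Or (Var p0) (Neg (Var p0)).
Definition Conj (P : Type) (p0 : P) (G : seq (form P)) : form P :=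
  foldr (@And P) (Top p0) G.

Record frame : Type := Frame {
  state : Type;
  state_nonempty : inhabited state;
  nbh : state -> set (set state) }.

Record model (P : Type) : Type := Model {
  base : frame;
  valuation : P -> set (state base) }.

Fixpoint truth_set (P : Type) (M : model P) (phi : form P) :
    set (state (base M)) :=
  match phi with
  | Var p => valuation M p
  | Neg a => [set s | ~ truth_set M a s]
  | And a b => [set s | truth_set M a s /\ truth_set M b s]
  | W a => [set s | nbh (base M) s (truth_set M a) /\ ~ truth_set M a s]
  end.

Definition sat (P : Type) (M : model P) (s : state (base M)) (phi : form P) :
  Prop := truth_set M phi s.

(* Propositional formulas over countably many schematic letters, independent
   of [P]: when [P] is small, tautologies over [P] itself would yield too few
   instances. *)
Inductive pform : Type :=
| PVar of nat
| PNeg of pform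
| PAnd of pform & pform.

Fixpoint peval (v : nat -> bool) (a : pform) : bool :=
  match a with
  | PVar n => v n
  | PNeg b => ~~ peval v b
  | PAnd b c => peval v b && peval v c
  end.

Definition tautology (a : pform) : Prop := forall v : nat -> bool, peval v a.

Fixpoint psubst (P : Type) (sigma : nat -> form P) (a : pform) : form P :=
  match a with
  | PVar n => sigma n
  | PNeg b => Neg (psubst sigma b)
  | PAnd b c => And (psubst sigma b) (psubst sigma c)
  end.

Inductive EW (P : Type) : form P -> Prop :=
| EW_taut (a : pform) (sigma : nat -> form P) :
    tautology a -> EW (psubst sigma a)
| EW_WE (phi : form P) : EW (Imp (W phi) (Neg phi))
| EW_MP (phi psi : form P) : EW (Imp phi psi) -> EW phi -> EW psi
| EW_REW (phi psi : form P) : EW (Iff phi psi) -> EW (Iff (W phi) (W psi)).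

(* A class of frames is a plain predicate: writing [set frame] would force the
   universe of states strictly below that of [set] and so rule out models whose
   states are sets of formulas. *)
Definition sound (P : Type) (thm : form P -> Prop) (C : frame -> Prop) : Prop :=
  forall phi : form P, thm phi ->
  forall M : model P, C (base M) -> forall s : state (base M), sat M s phi.

Definition consequence (P : Type) (C : frame -> Prop) (Gamma : set (form P))
    (phi : form P) : Prop :=
  forall M : model P, C (base M) -> forall s : state (base M),
  (forall psi : form P, Gamma psi -> sat M s psi) -> sat M s phi.

Definition strongly_complete (P : Type) (p0 : P) (thm : form P -> Prop)
    (C : frame -> Prop) : Prop :=
  forall (Gamma : set (form P)) (phi : form P), consequence C Gamma phi ->
  exists Gamma0 : seq (form P),
    (forall psi : form P, List.In psi Gamma0 -> Gamma psi) /\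
    thm (Imp (Conj p0 Gamma0) phi).

Definition all_frames : frame -> Prop := fun _ => True.

(* Main.v *)
From mathcomp Require Import all_boot.
From mathcomp Require Import boolp classical_sets.
Require Import Defs.

(** Completeness is by a canonical model whose states are the maximal consistent
    sets and where a set of states is a neighborhood of [s] iff it is the proof
    set of some [a] with [W a] in [s]. The choice of [a] is immaterial: formulas
    with the same proof set are provably equivalent, so [REW] applies; and [WE]
    gives the second conjunct of the truth condition of [W a]. *)

Set Implicit Arguments.
Unset Strict Implicit.
Unset Printing Implicit Defensive.

Local Open Scope classical_set_scope.

(** * Soundness over an arbitrary class of frames *)

Section Soundness.
Variables (P : Type) (M : model P).

Lemma truth_set_Imp (a b : form P) (s : state (base M)) :
  truth_set M (Imp a b) s <-> (truth_set M a s -> truth_set M b s).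
Proof.
split=> [nab sa | ab [sa nsb]]; last exact: nsb (ab sa).
by apply: contrapT => nsb; apply: nab.
Qed.

Lemma truth_set_Iff (a b : form P) (s : state (base M)) :
  truth_set M (Iff a b) s <-> (truth_set M a s <-> truth_set M b s).
Proof.
split=> [[/truth_set_Imp ab /truth_set_Imp ba] //| [ab ba]].
by split; apply/truth_set_Imp.
Qed.

(** At a fixed state, classical truth of the substituted formulas is a Boolean valuation of the
    schematic letters, so every instance of a tautology is true there. *)
Lemma truth_set_psubst (sigma : nat -> form P) (a : pform)
    (s : state (base M)) :
  truth_set M (psubst sigma a) s <->
  peval (fun n => `[< truth_set M (sigma n) s >]) a.
Proof.
elim: a => [n | b IHb | b IHb c IHc] /=.
- by split=> /asboolP.
- by split=> [nb | /negP nb]; [apply/negP|]; move/IHb.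
- by split=> [[/IHb -> /IHc ->] // | /andP[/IHb ? /IHc ?]].
Qed.

End Soundness.

Lemma EW_sound (P : Type) (C : frame -> Prop) : sound (@EW P) C.
Proof.
move=> phi thm_phi M _; rewrite /sat.
elim: phi / thm_phi => [a sigma taut_a | a | a b _ IHab _ IHa | a b _ IHab] s.
- exact/truth_set_psubst/taut_a.
(* [WE]: the truth condition of [W a] already contains the falsity of [a]. *)
- by apply/truth_set_Imp => -[].
- by apply: (iffLR (truth_set_Imp _ _ _) (IHab s)); apply: IHa.
(* [REW]: the truth of [W a] depends on [a] only through its truth set, and validity of the premise
   at every state makes the two truth sets equal. *)
- suff eq_ab : truth_set M a = truth_set M b.
    by apply/truth_set_Iff; rewrite /= eq_ab.
  by apply/seteqP; split=> t; case: (iffLR (truth_set_Iff _ _ _) (IHab t)).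
Qed.

(** * Propositional reasoning in the calculus *)

Definition PImp (a b : pform) : pform := PNeg (PAnd a (PNeg b)).

Section Derivability.
Variables (P : Type) (p0 : P).
Implicit Types (a b c phi psi : form P) (G H : set (form P)).
Implicit Types l : seq (form P).

Let x := PVar 0.
Let y := PVar 1.
Let z := PVar 2.

(** Letters past [z] receive the default [a]; the tautologies below contain only [x], [y] and
    [z]. *)
Let inst a b c (n : nat) : form P := nth a [:: a; b; c] n.

Lemma EW_taut3 (t : pform) a b c : tautology t -> EW (psubst (inst a b c) t).
Proof. exact: EW_taut. Qed.

Ltac taut := let v := fresh "v" in
  move=> v /=; case: (v 0); case: (v 1); case: (v 2).

Lemma EW_weaken a b : EW b -> EW (Imp a b).
Proof.
apply: EW_MP.
by apply: (EW_taut3 (t := PImp x (PImp y x)) b a a); taut.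
Qed.

Lemma EW_S a b c : EW (Imp (Imp a (Imp b c)) (Imp (Imp a b) (Imp a c))).
Proof.
by apply: (EW_taut3
  (t := PImp (PImp x (PImp y z)) (PImp (PImp x y) (PImp x z))) a b c); taut.
Qed.

Lemma EW_Imp_MP a b c : EW (Imp a (Imp b c)) -> EW (Imp a b) -> EW (Imp a c).
Proof. by move=> abc; apply/EW_MP/EW_MP/abc/EW_S. Qed.

Lemma EW_trans a b c : EW (Imp a b) -> EW (Imp b c) -> EW (Imp a c).
Proof. by move=> ab bc; apply: EW_Imp_MP ab; apply: EW_weaken. Qed.

Lemma EW_pair a b : EW (Imp a (Imp b (And a b))).
Proof. by apply: (EW_taut3 (t := PImp x (PImp y (PAnd x y))) a b a); taut. Qed.

Lemma EW_AndI a b c : EW (Imp a b) -> EW (Imp a c) -> EW (Imp a (And b c)).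
Proof.
move=> ab ac; apply: EW_Imp_MP ac; apply: EW_Imp_MP ab.
exact/EW_weaken/EW_pair.
Qed.

Lemma EW_AndEl a b : EW (Imp (And a b) a).
Proof. by apply: (EW_taut3 (t := PImp (PAnd x y) x) a b a); taut. Qed.

Lemma EW_AndEr a b : EW (Imp (And a b) b).
Proof. by apply: (EW_taut3 (t := PImp (PAnd x y) y) a b a); taut. Qed.

Lemma EW_curry a b c : EW (Imp (And a b) c) -> EW (Imp b (Imp a c)).
Proof.
apply: EW_MP; by apply: (EW_taut3
  (t := PImp (PImp (PAnd x y) z) (PImp y (PImp x z))) a b c); taut.
Qed.

Lemma EW_explosion a b : EW (Imp a (Imp (Neg a) b)).
Proof. by apply: (EW_taut3 (t := PImp x (PImp (PNeg x) y)) a b a); taut. Qed.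

Lemma EW_cases a b : EW (Imp (Imp a b) (Imp (Imp (Neg a) b) b)).
Proof.
by apply: (EW_taut3
  (t := PImp (PImp x y) (PImp (PImp (PNeg x) y) y)) a b a); taut.
Qed.

Lemma EW_Top : EW (Top p0).
Proof.
by apply: (EW_taut3 (t := PNeg (PAnd (PNeg x) (PNeg (PNeg x))))
  (Var p0) (Var p0) (Var p0)); taut.
Qed.

Lemma EW_Conj_mem l a : List.In a l -> EW (Imp (Conj p0 l) a).
Proof.
elim: l => //= b l IHl [-> | /IHl]; first exact: EW_AndEl.
exact/EW_trans/EW_AndEr.
Qed.

Lemma EW_ConjI l a :
  (forall b, List.In b l -> EW (Imp a b)) -> EW (Imp a (Conj p0 l)).
Proof.
elim: l => [_ | b l IHl al] /=; first exact/EW_weaken/EW_Top.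
by apply: EW_AndI; [apply: al; left | apply: IHl => c lc; apply: al; right].
Qed.

(** * Derivability from a set of hypotheses *)

Definition derives G phi : Prop :=
  exists l, (forall psi, List.In psi l -> G psi) /\ EW (Imp (Conj p0 l) phi).

Lemma derives_thm G phi : EW phi -> derives G phi.
Proof. by move=> thm; exists [::]; split=> //; apply: EW_weaken. Qed.

Lemma derives_hyp G phi : G phi -> derives G phi.
Proof.
move=> Gphi; exists [:: phi]; split=> [psi [<-|[]] //|]; exact: EW_AndEl.
Qed.

Lemma derives_MP G a b : derives G (Imp a b) -> derives G a -> derives G b.
Proof.
move=> [l1 [Gl1 thm1]] [l2 [Gl2 thm2]]; exists (l1 ++ l2); split.
  by move=> psi /(List.in_app_or l1 l2)[/Gl1|/Gl2].
have sub l : (forall c, List.In c l -> List.In c (l1 ++ l2)) ->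
    EW (Imp (Conj p0 (l1 ++ l2)) (Conj p0 l)).
  by move=> ll; apply: EW_ConjI => c /ll; apply: EW_Conj_mem.
apply: (EW_Imp_MP (EW_trans _ thm1)); last apply: (EW_trans _ thm2).
- by apply: sub => c lc; apply: (List.in_or_app l1 l2); left.
- by apply: sub => c lc; apply: (List.in_or_app l1 l2); right.
Qed.

Lemma derives_EW G a b : EW (Imp a b) -> derives G a -> derives G b.
Proof. by move=> thm; apply/derives_MP/derives_thm. Qed.

Lemma derives_deduction G a b : derives (a |` G) b -> derives G (Imp a b).
Proof.
move=> [l [Gl thm]].
(* The list [l'] is [l] with the occurrences of [a] that are not taken from [G] removed; the
   conjunct [a] makes up for them. *)
suff [l' [Gl' thm']] : exists l', (forall psi, List.In psi l' -> G psi) /\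
    EW (Imp (And a (Conj p0 l')) (Conj p0 l)).
  by exists l'; split=> //; apply/EW_curry/EW_trans/thm.
elim: l Gl {thm} => [_ | c l IHl Gl].
  by exists [::]; split=> //; apply: EW_AndEr.
have [|l' [Gl' thm']] := IHl; first by move=> psi lpsi; apply: Gl; right.
have [-> | Gc] := Gl c (or_introl erefl).
  by exists l'; split=> //; apply: EW_AndI => //; apply: EW_AndEl.
exists (c :: l'); split=> [psi [<-|/Gl'] //|] /=; apply: EW_AndI.
- exact: EW_trans (EW_AndEr _ _) (EW_AndEl _ _).
- apply: EW_trans thm'; apply: EW_AndI; first exact: EW_AndEl.
  exact: EW_trans (EW_AndEr _ _) (EW_AndEr _ _).
Qed.

(** * Maximal consistent sets *)

(** Consistency is implicit: an inconsistent closed set would contain a formula along with its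
    negation, against the second clause. That clause also gives maximality. *)
Definition mcs G : Prop :=
  (forall phi, derives G phi -> G phi) /\
  (forall phi, G (Neg phi) <-> ~ G phi).

Lemma mcs_And G a b : mcs G -> G (And a b) <-> G a /\ G b.
Proof.
move=> [clG _]; split=> [/derives_hyp Gab | [/derives_hyp Ga /derives_hyp Gb]].
  split; apply: clG; [exact/derives_EW/Gab/EW_AndEl|].
  exact/derives_EW/Gab/EW_AndEr.
by apply: clG; apply: derives_MP Gb; apply/derives_EW/Ga/EW_pair.
Qed.

(** Maximality here is among the sets that do not derive [phi]. If both [psi] and its negation were
    missing, adding either one would yield [phi], hence [G] alone would, by cases. *)
Lemma maximal_mcs G phi : ~ derives G phi ->
  (forall psi, ~ G psi -> derives (psi |` G) phi) -> mcs G.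
Proof.
move=> Gphi maxG; split=> [psi Gpsi | psi].
  apply: contrapT => /maxG/derives_deduction thm.
  exact/Gphi/derives_MP/Gpsi.
split=> [/derives_hyp Gnpsi /derives_hyp Gpsi | nGpsi].
  by apply: Gphi; apply: derives_MP Gnpsi; apply/derives_EW/Gpsi/EW_explosion.
apply: contrapT => /maxG/derives_deduction npsi_phi.
move/maxG: nGpsi => /derives_deduction psi_phi.
by apply: Gphi; apply: derives_MP npsi_phi; apply/derives_EW/psi_phi/EW_cases.
Qed.

(** A derivation uses finitely many premises, and among the finitely many members of the chain
    supplying them one contains the others. The first alternative covers derivations with all
    premises in [G], in particular the empty chain. *)
Lemma derives_bigcup_chain G (F : set (set (form P))) phi :
  total_on F subset -> derives (G `|` \bigcup_(X in F) X) phi ->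
  derives G phi \/ exists2 X, F X & derives (G `|` X) phi.
Proof.
move=> totF [l [Gl thm]].
suff [Gl' | [X FX Xl]] : (forall psi, List.In psi l -> G psi) \/
    exists2 X, F X & forall psi, List.In psi l -> (G `|` X) psi.
- by left; exists l.
- by right; exists X => //; exists l.
elim: l Gl {thm} => [_ | c l IHl Gl]; first by left.
have Gl' psi : List.In psi l -> (G `|` \bigcup_(X in F) X) psi.
  by move=> lpsi; apply: Gl; right.
have [Gc | [Y FY Yc]] := Gl c (or_introl erefl);
  have [{}Gl' | [X FX Xl]] := IHl Gl'.
- by left=> psi [<-|/Gl'].
- by right; exists X => // psi [<-|/Xl //]; left.
- by right; exists Y => // psi [<-|/Gl']; [right|left].
- have [XY | YX] := totF X Y FX FY.
  + by right; exists Y => // psi [<-|/Xl[|/XY]]; [right|left|right].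
  + by right; exists X => // psi [<-|/Xl //]; right; apply: YX.
Qed.

Lemma Lindenbaum G phi : ~ derives G phi ->
  exists2 H, G `<=` H & mcs H /\ ~ H phi.
Proof.
move=> Gphi.
(* Zorn's lemma ranges over the sets [X] to be added to [G], not over supersets of [G]: the union of
   the empty chain is then admissible too. *)
have [F FP totF /(derives_bigcup_chain totF)[//|[X /FP]//]|A [Aphi maxA]] :=
  @Zorn_bigcup _ [set X | ~ derives (G `|` X) phi].
exists (G `|` A); first exact: subsetUl.
split; last by move/derives_hyp.
apply: (maximal_mcs Aphi) => psi nGApsi.
have ltA : A `<` (psi |` A).
  split; first exact: subsetUr.
  by move=> /(_ psi (or_introl erefl)) Apsi; apply: nGApsi; right.
by have := maxA _ ltA; rewrite /= setUCA => /contrapT.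
Qed.

Lemma mcs_Imp G a b : mcs G -> G (Imp a b) <-> (G a -> G b).
Proof.
move=> mcsG; have [_ negG] := mcsG.
split=> [/negG nGab Ga | Gab].
  apply: contrapT => /negG Gnb; apply: nGab.
  by apply/(mcs_And _ _ mcsG).
by apply/negG => /(mcs_And _ _ mcsG)[/Gab Gb /negG].
Qed.

(** Lindenbaum's lemma from no hypotheses, in contrapositive form. *)
Lemma EW_of_mcs phi : (forall G, mcs G -> G phi) -> EW phi.
Proof.
move=> all_phi; suff [[|c l] [l0 thm]] : derives set0 phi.
- exact: EW_MP thm EW_Top.
- by case: (l0 c (or_introl erefl)).
by apply: contrapT => /Lindenbaum[G _ [/all_phi]].
Qed.

Lemma EW_Iff_of_mcs a b :
  (forall G, mcs G -> G a <-> G b) -> EW (Iff a b).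
Proof.
move=> ab; apply: EW_of_mcs => G mcsG.
by apply/(mcs_And _ _ mcsG); split; apply/(mcs_Imp _ _ mcsG) => /(ab G mcsG).
Qed.

Lemma mcs_REW G a b :
  (forall H, mcs H -> H a <-> H b) -> mcs G -> G (W a) -> G (W b).
Proof.
move=> /EW_Iff_of_mcs/EW_REW thm [clG _] /derives_hyp GWa.
exact/clG/derives_EW/GWa/(EW_MP (EW_AndEl _ _) thm).
Qed.

Lemma mcs_WE G a : mcs G -> G (W a) -> ~ G a.
Proof.
move=> [clG negG] /derives_hyp GWa.
exact/negG/clG/derives_EW/GWa/EW_WE.
Qed.

(** * Canonical model and completeness *)

Definition canonical_nbh (s : {G | mcs G}) : set (set {G | mcs G}) :=
  [set X | exists2 a, sval s (W a) & X = [set t | sval t a]].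

(** The state [s0] witnesses that the frame is nonempty. *)
Definition canonical_model (s0 : {G | mcs G}) : model P :=
  @Model P (Frame (inhabits s0) canonical_nbh)
    (fun p => [set s | sval s (Var p)]).

Lemma truth_lemma s0 phi :
  truth_set (canonical_model s0) phi = [set s | sval s phi].
Proof.
elim: phi => [// | a IHa | a IHa b IHb | a IHa] /=.
- rewrite IHa; apply/seteqP.
  by split=> -[G mcsG] /=; have [_ negG] := mcsG; move/negG.
- rewrite IHa IHb; apply/seteqP.
  by split=> -[G mcsG] /= /(mcs_And _ _ mcsG).
- rewrite IHa; apply/seteqP; split=> -[G mcsG] /=.
    move=> [[b GWb eq_ab] _]; apply: mcs_REW mcsG GWb => H mcsH.
    (* Evaluating the equality of proof sets at the state [H] shows that [H] contains [a] iff it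
       contains [b]. *)
    by have := congr1 (fun X => X (exist _ H mcsH)) eq_ab => /= ->.
  by move=> GWa; split; [exists a | apply: mcs_WE GWa].
Qed.

Lemma EW_strongly_complete : strongly_complete p0 (@EW P) all_frames.
Proof.
(* If [G] did not derive [phi], a maximal consistent extension of [G] omitting [phi] would be a
   canonical state refuting the consequence. *)
move=> G phi Gphi; change (derives G phi).
apply: contrapT => /Lindenbaum[H GH [mcsH nHphi]].
pose s : {G | mcs G} := exist _ H mcsH.
have := Gphi (canonical_model s) I s; rewrite /sat truth_lemma /=.
by move=> /(_ _)/nHphi; apply=> psi /GH; rewrite truth_lemma.
Qed.

End Derivability.

(* [p0] witnesses that the set of propositional variables is nonempty. *)
Theorem theorem5p21 (P : Type) (p0 : P) :
  sound (@EW P) all_frames /\ strongly_complete p0 (@EW P) all_frames.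
Proof. by split; [apply: EW_sound | apply: EW_strongly_complete]. Qed.
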